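(* The Galois invariant ${\rm tot}$ of a dessin is independent of (that is, not determined by) its monodromy group, point stabilisers and automorphism group, as abstract groups, together with its passport: there exist dessins $\mathcal D$ and $\mathcal E$ with isomorphic monodromy groups, isomorphic point stabilisers in these monodromy groups, isomorphic automorphism groups and the same passport, such that ${\rm tot}(\mathcal D)\ne{\rm tot}(\mathcal E)$.
   Context: A dessin (d'enfant) $\mathcal D$ is a connected finite bipartite graph, with vertices coloured white or black so that each edge joins a white to a black vertex, embedded in a closed oriented surface so that the components of the complement (the faces) are open discs. Let $\sigma_0$ and $\sigma_1$ be the permutations of the $n$ edges given by the cyclic order of edges around white and black vertices respectively, and $\sigma_\infty=(\sigma_0\sigma_1)^{-1}$; the cycles of $\sigma_0,\sigma_1,\sigma_\infty$ correspond to white vertices, black vertices and faces. Up to equivalence, dessins correspond to pairs $(\sigma_0,\sigma_1)$ of permutations generating a transitive subgroup of $S_n$, up to simultaneous conjugacy. The monodromy group is $M=\langle\sigma_0,\sigma_1\rangle$; a point stabiliser is the stabiliser in $M$ of an edge; the automorphism group is the group of orientation-preserving, colour-preserving automorphisms of the embedded graph, isomorphic to the centraliser of $M$ in $S_n$. The passport is the triple of multisets of degrees of white vertices, black vertices and faces (a face of degree $r$ being a polygon with $2r$ sides), i.e. the triple of cycle structures of $\sigma_0,\sigma_1,\sigma_\infty$. A dessin is Z-orientable if its faces can be labelled $+$ or $-$ so that each edge is incident with two faces having different labels (so a dessin having an edge with the same face on both sides is not Z-orientable). Let $\mathcal D'$ and $\mathcal D''$ be the dessins corresponding to the triples $(\sigma_1,\sigma_\infty,\sigma_0)$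 and $(\sigma_\infty,\sigma_0,\sigma_1)$ in place of $(\sigma_0,\sigma_1,\sigma_\infty)$. The twist-invariant orientability type ${\rm tot}(\mathcal D)$ is the number of Z-orientable dessins in the triple $\mathcal D,\mathcal D',\mathcal D''$ (counted as a triple). *)

(* Defs.v *)
From mathcomp Require Import all_boot all_fingroup.

Set Implicit Arguments.
Unset Strict Implicit.
Unset Printing Implicit Defensive.

Local Open Scope group_scope.

(* A dessin with n edges is given by the cyclic orders (say anticlockwise) of
   its edges around the white and the black vertices; connectedness is
   transitivity. Transitivity on [set: 'I_n] forces 0 < n. Permutations act on
   the right, (s * t) e = t (s e). *)
Record dessin (n : nat) := Dessin {
  sigma0 : 'S_n;
  sigma1 : 'S_n;
  dessin_trans : [transitive <<[set sigma0; sigma1]>>, on [set: 'I_n] | 'P]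
}.

Definition sigmaoo n (D : dessin n) : 'S_n := (sigma0 D * sigma1 D)^-1.

Definition monodromy n (D : dessin n) : {group 'S_n} :=
  <<[set sigma0 D; sigma1 D]>>%G.

Definition edge_stab n (D : dessin n) (e : 'I_n) : {group 'S_n} :=
  'C_(monodromy D)[e | 'P]%G.

(* An automorphism is determined by its action on the edges; preserving
   orientation and colours means preserving both families of cyclic orders. *)
Definition dessin_aut_set n (D : dessin n) : {set 'S_n} :=
  [set a : 'S_n | [forall e, (a (sigma0 D e) == sigma0 D (a e))
                          && (a (sigma1 D e) == sigma1 D (a e))]].

Lemma dessin_aut_setE n (D : dessin n) : dessin_aut_set D = 'C(monodromy D).
Proof.
apply/setP => a; rewrite cent_gen inE; apply/forallP/centP => [aP s | aC e].
  by case/set2P=> ->; apply/permP=> e; rewrite !permM;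
     have /andP[/eqP a0 /eqP a1] := aP e.
have c0 : commute a (sigma0 D) by apply: aC; rewrite !inE eqxx.
have c1 : commute a (sigma1 D) by apply: aC; rewrite !inE eqxx orbT.
by apply/andP; rewrite -!permM c0 c1.
Qed.

Lemma dessin_aut_group_set n (D : dessin n) : group_set (dessin_aut_set D).
Proof. by rewrite dessin_aut_setE groupP. Qed.

Definition dessin_aut n (D : dessin n) : {group 'S_n} :=
  Group (dessin_aut_group_set D).

(* Multisets of natural numbers are encoded as sorted sequences. *)
Definition cycle_structure n (s : 'S_n) : seq nat :=
  sort leq [seq #|c| | c : {set 'I_n} in porbits s].

Definition passport n (D : dessin n) : seq nat * seq nat * seq nat :=
  (cycle_structure (sigma0 D), cycle_structure (sigma1 D),
   cycle_structure (sigmaoo D)).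

(* The cycle of sigmaoo through e is the face on the left of e, seen from its
   white end: the corners between e, sigma0 e and sigma1 (sigma0 e) lie in it.
   The corner between e and sigma1 e at their black vertex lies in the face on
   the right of e, which is the face on the left of sigma1 e. *)
Definition left_face n (D : dessin n) (e : 'I_n) : {set 'I_n} :=
  porbit (sigmaoo D) e.

Definition right_face n (D : dessin n) (e : 'I_n) : {set 'I_n} :=
  porbit (sigmaoo D) (sigma1 D e).

(* The values of the labelling outside porbits (sigmaoo D) are irrelevant. *)
Definition Z_orientable n (D : dessin n) : bool :=
  [exists label : {ffun {set 'I_n} -> bool},
     [forall e, label (left_face D e) != label (right_face D e)]].

Lemma twist_trans n (D : dessin n) :
  [transitive <<[set sigma1 D; sigmaoo D]>>, on [set: 'I_n] | 'P].
Proof.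
suff <- : <<[set sigma0 D; sigma1 D]>> = <<[set sigma1 D; sigmaoo D]>>.
  exact: dessin_trans.
apply/eqP; rewrite eqEsubset !gen_subG; apply/andP; split; apply/subsetP=> s.
  case/set2P=> ->; last by rewrite mem_gen // !inE eqxx.
  have -> : sigma0 D = (sigma1 D * sigmaoo D)^-1.
    by rewrite /sigmaoo !invMg !invgK mulgK.
  by rewrite groupV groupM // mem_gen // !inE eqxx ?orbT.
case/set2P=> ->; first by rewrite mem_gen // !inE eqxx orbT.
by rewrite groupV groupM // mem_gen // !inE eqxx ?orbT.
Qed.

(* The dessin of the triple (sigma1, sigmaoo, sigma0). *)
Definition twist n (D : dessin n) : dessin n := Dessin (twist_trans D).

Lemma sigmaoo_twist n (D : dessin n) : sigmaoo (twist D) = sigma0 D.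
Proof. by rewrite /sigmaoo /= /sigmaoo !invMg !invgK mulgK. Qed.

(* twist (twist D) is the dessin of the triple (sigmaoo, sigma0, sigma1). *)
Lemma twist_twistE n (D : dessin n) :
  [/\ sigma0 (twist (twist D)) = sigmaoo D,
      sigma1 (twist (twist D)) = sigma0 D
    & sigmaoo (twist (twist D)) = sigma1 D].
Proof. by split; rewrite ?sigmaoo_twist //= sigmaoo_twist. Qed.

Definition tot n (D : dessin n) : nat :=
  Z_orientable D + Z_orientable (twist D) + Z_orientable (twist (twist D)).

(* Main.v *)
(* The number tot D is the number of subgroups of index 2 in the monodromy group
   that contain the stabiliser of an edge. Let G be the wreath product
   C_2 wr C_3 (isomorphic to C_2 x A_4): it has exactly one subgroup of index 2,
   the elements of even weight. Its non-central involutions d = (0,1,1), of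
   even weight, and e = (1,0,0), of odd weight, have isomorphic C_G(d)/<d> and
   C_G(e)/<e>. Letting the same generating pair of G act on the cosets of <d>
   and of <e> gives dessins with tot 1 and 0. No nontrivial power of either
   generator or of their product is conjugate to d or e, so all of them act
   semiregularly, and the passport depends only on their orders.

   The cosets are modelled by Z_3 x F_2^2, a vector v of G translating the fibre
   above i by L (shift i v), for a linear map L : F_2^3 -> F_2^2 whose kernel is
   the stabiliser of the edges above 0; the automorphisms are the translations
   of F_2^2. *)

Require Import Defs.
From HB Require Import structures.
From mathcomp Require Import all_boot all_fingroup all_algebra all_solvable.

Set Implicit Arguments.
Unset Strict Implicit.
Unset Printing Implicit Defensive.

Import GroupScope GRing.Theory.

(** * The wreath product of C_2 by C_3 and a generating pair *)

Local Notation V := {ffun 'Z_3 -> bool}.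

Definition shift (i : 'Z_3) (v : V) : V := [ffun k => v (k + i)%R].

Lemma shiftD i v w : shift i (v + w)%R = (shift i v + shift i w)%R.
Proof. by apply/ffunP=> k; rewrite !ffunE. Qed.

Lemma shift_shift i j v : shift i (shift j v) = shift (i + j)%R v.
Proof. by apply/ffunP=> k; rewrite !ffunE addrA. Qed.

Lemma shift0 v : shift 0%R v = v.
Proof. by apply/ffunP=> k; rewrite !ffunE addr0. Qed.

Lemma shiftr0 i : shift i 0%R = 0%R.
Proof. by apply/ffunP=> k; rewrite !ffunE. Qed.

(** Nonzero elements of Z_3 square to 1, so [j = j * i * i] is a multiple of [i], and the shift by
    [j] iterates the one by [i]. *)
Lemma shift_fixed i v : i != 0%R -> shift i v = v -> forall j, shift j v = v.
Proof.
move=> i0 fixi j; have ii : (i * i = 1)%R.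
  by case: i i0 {fixi} => [[|[|[]]]] //= ? _; apply: val_inj.
rewrite -[j]mulr1 -ii mulrCA -[(j * i)%R]natr_Zp mulr_natr.
by elim: (nat_of_ord _) => [|q IHq]; rewrite ?shift0 // mulrS -shift_shift IHq.
Qed.

Lemma ffun_boolDD (v : V) : (v + v)%R = 0%R.
Proof. by apply/ffunP=> k; rewrite !ffunE; case: (v k). Qed.

Definition wreath : Type := (V * 'Z_3)%type.
HB.instance Definition _ := Finite.on wreath.

Definition wr_mul (g h : wreath) : wreath := (g.1 + shift g.2 h.1, g.2 + h.2)%R.
Definition wr_one : wreath := (0, 0)%R.
Definition wr_inv (g : wreath) : wreath := (shift (- g.2) g.1, - g.2)%R.

Lemma wr_mulA : associative wr_mul.
Proof.
by move=> g h k; rewrite /wr_mul /= shiftD shift_shift !addrA.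
Qed.

Lemma wr_mul1 : left_id wr_one wr_mul.
Proof. by case=> v i; rewrite /wr_mul /= shift0 !add0r. Qed.

Lemma wr_mulV : left_inverse wr_one wr_inv wr_mul.
Proof. by case=> v i; rewrite /wr_mul /= ffun_boolDD addNr. Qed.

HB.instance Definition _ := Finite_isGroup.Build wreath wr_mulA wr_mul1 wr_mulV.

Lemma wr_mulE (g h : wreath) : g * h = (g.1 + shift g.2 h.1, g.2 + h.2)%R.
Proof. by []. Qed.

Lemma card_wreath : #|[set: wreath]| = 24.
Proof. by rewrite cardsT card_prod card_ffun card_bool card_ord. Qed.

Definition delta (i : 'Z_3) : V := [ffun k => k == i].
Definition rot : wreath := (0, 1)%R.
Definition wx : wreath := (delta 0, 1)%R.
(** Chosen so that the faces are given by [rot]; all of [wx], [wy] and [rot] have rotation part 1,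
    since -2 = 1 in Z_3. *)
Definition wy : wreath := wx^-1 * rot^-1.

Lemma wx_wy : (wx * wy)^-1 = rot.
Proof. by rewrite /wy mulKVg invgK. Qed.

Lemma rotX k : rot ^+ k = (0, k%:R)%R.
Proof.
elim: k => [|k IHk]; first by rewrite expg0.
by rewrite expgS IHk wr_mulE /= shiftr0 addr0 -natr1 addrC.
Qed.

Lemma wreath_gen : <<[set wx; wy]>> = [set: wreath].
Proof.
set G := <<_>>; apply/setP=> g; rewrite [RHS]inE.
have Gx : wx \in G by rewrite mem_gen ?set21.
have Gr : rot \in G by rewrite -wx_wy groupV groupM // mem_gen ?set22.
have Grot i : ((0%R, i) : wreath) \in G.
  by rewrite -[i]natr_Zp -rotX groupX.
have Gd i : ((delta i, 0%R) : wreath) \in G.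
  (* The left factor moves the vector [delta 0] of [wx] to [delta i]; the right one cancels the
     rotation. *)
  have -> : (delta i, 0%R) = ((0%R, (- i)%R) : wreath) * wx * (0%R, (i - 1)%R).
    rewrite !wr_mulE /= shiftr0 add0r addr0; congr (_, _).
      by apply/ffunP=> k; rewrite !ffunE subr_eq0.
    by rewrite addrACA addNr addrN addr0.
  by rewrite !groupM.
have Gv v : ((v, 0%R) : wreath) \in G.
  have -> : v = (\sum_(i | v i) delta i)%R.
    apply/ffunP=> k; rewrite sum_ffunE.
    rewrite (eq_bigr (fun i => (k == i)%:R)%R) => [|i _]; last first.
      by rewrite ffunE; case: eqP.
    case vk: (v k).
      rewrite (bigD1 k) //= eqxx big1 ?addr0 // => i /andP[_ /negPf].
      by rewrite eq_sym => ->.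
    by rewrite big1 // => i vi; case: eqP => // ki; rewrite -ki vk in vi.
  elim/big_ind: _ => [|u w Gu Gw|//]; first exact: group1.
  by have := groupM Gu Gw; rewrite wr_mulE /= shift0 addr0.
case: g => v i.
have -> : (v, i) = ((v, 0%R) : wreath) * (0%R, i).
  by rewrite wr_mulE /= shiftr0 addr0 add0r.
by rewrite groupM.
Qed.

(** * The dessin of a linear map [L]: monodromy, stabilisers, automorphisms, cycle lengths *)

Section Action.

Variables (L : {additive V -> bool * bool}).

Local Notation T := ('Z_3 * (bool * bool))%type.
Local Notation n := #|{: T}|.

Definition wr_act (t : T) (g : wreath) : T :=
  (t.1 + g.2, t.2 + L (shift t.1 g.1))%R.

Lemma wr_act1 t : wr_act t 1 = t.
Proof. by case: t => i u; rewrite /wr_act /= shiftr0 raddf0 !addr0. Qed.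

Lemma wr_actM t g h : wr_act t (g * h) = wr_act (wr_act t g) h.
Proof.
by case: t => i u; rewrite /wr_act /= shiftD raddfD shift_shift !addrA.
Qed.

Lemma wr_actK g : cancel (wr_act^~ g) (wr_act^~ g^-1).
Proof. by move=> t; rewrite -wr_actM mulgV wr_act1. Qed.

Definition wr_actn (g : wreath) (e : 'I_n) : 'I_n :=
  enum_rank (wr_act (enum_val e) g).

Lemma wr_actn_inj g : injective (wr_actn g).
Proof.
exact: inj_comp enum_rank_inj (inj_comp (can_inj (wr_actK g)) enum_val_inj).
Qed.

Definition rho (g : wreath) : 'S_n := perm (@wr_actn_inj g).

Lemma rho_rank g t : rho g (enum_rank t) = enum_rank (wr_act t g).
Proof. by rewrite permE /wr_actn enum_rankK. Qed.

Lemma rhoE g e : enum_val (rho g e) = wr_act (enum_val e) g.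
Proof. by rewrite permE enum_rankK. Qed.

Lemma rhoM : {in [set: wreath] &, {morph rho : g h / g * h}}.
Proof.
move=> g h _ _; apply/permP=> e; apply: enum_val_inj.
by rewrite permM !rhoE wr_actM.
Qed.

Canonical rho_morphism := Morphism rhoM.

(** In turn, these give transitivity, faithfulness, and a stabiliser element that singles out the
    fibre above 0. *)
Hypothesis Lsurj : forall u, exists v, L v = u.
Hypothesis Lfaithful : forall v, (forall i, L (shift i v) = 0%R) -> v = 0%R.
Hypothesis Lker :
  exists2 k, L k = 0%R & forall i, i != 0%R -> L (shift i k) <> 0%R.

Lemma rho_inj : 'injm rho.
Proof.
apply/subsetP=> -[v i] /mker rg1; apply/set1P.
have fixt t : wr_act t (v, i) = t by rewrite -(enum_rankK t) -rhoE rg1 perm1.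
have i0 : i = 0%R by have /(congr1 fst) := fixt (0%R, 0%R); rewrite /= add0r.
congr (_, _) => //; apply: Lfaithful => j.
by have /(congr1 snd) := fixt (j, 0%R); rewrite /= add0r.
Qed.

Lemma rho_im : rho @* [set: wreath] = <<[set rho wx; rho wy]>>.
Proof.
rewrite -[X in rho @* X]wreath_gen morphim_gen ?subsetT //.
by rewrite morphimU !morphim_set1 ?inE.
Qed.

Definition base_edge : 'I_n := enum_rank ((0, 0)%R : T).

Lemma rho_trans : [transitive <<[set rho wx; rho wy]>>, on [set: 'I_n] | 'P].
Proof.
rewrite -rho_im; apply/imsetP; exists base_edge; rewrite ?inE //.
apply/esym/setP=> e; rewrite inE; apply/orbitP.
have [v Lv] := Lsurj (enum_val e).2.
(* The element [(v, i)] sends the base edge to [(i, L v)]. *)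
exists (rho (v, (enum_val e).1)); first by apply: mem_morphim; rewrite inE.
apply: enum_val_inj.
rewrite /= apermE rhoE enum_rankK /wr_act /= shift0 !add0r Lv.
by case: (enum_val e).
Qed.

Definition wr_dessin : dessin n := Dessin rho_trans.
Local Notation D := wr_dessin.

Lemma wr_sigmaoo : sigmaoo D = rho rot.
Proof. by rewrite /sigmaoo /= -rhoM ?inE // -morphV ?inE // wx_wy. Qed.

Lemma wr_monodromy_isog : [set: wreath] \isog monodromy D.
Proof. by rewrite /= -rho_im sub_isog ?rho_inj. Qed.

Lemma card_edges : n = 12.
Proof. by rewrite !card_prod card_bool card_ord. Qed.

Lemma card_edge_stab e : #|edge_stab D e| = 2.
Proof.
have : (n * #|edge_stab D e|)%N = 24.
  have orbe : orbit 'P (monodromy D) e = [set: 'I_n].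
    exact: (atransP rho_trans) (in_setT e).
  rewrite -card_wreath (card_isog wr_monodromy_isog).
  by rewrite -(card_orbit_stab 'P (monodromy D) e) orbe cardsT card_ord.
move: #|edge_stab D e| => c; rewrite card_edges => /eqP.
by rewrite -[24]/(12 * 2)%N eqn_pmul2l // => /eqP.
Qed.

Definition transl_fun (u : bool * bool) (e : 'I_n) : 'I_n :=
  enum_rank ((enum_val e).1, (enum_val e).2 + u)%R.

Lemma transl_inj u : injective (transl_fun u).
Proof.
apply: (can_inj (g := transl_fun (- u)%R)) => e.
by rewrite /transl_fun enum_rankK /= addrK -surjective_pairing enum_valK.
Qed.

Definition transl u : 'S_n := perm (@transl_inj u).

Lemma translE u e :
  enum_val (transl u e) = ((enum_val e).1, (enum_val e).2 + u)%R.
Proof. by rewrite permE enum_rankK. Qed.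

Lemma commute_transl u g : commute (transl u) (rho g).
Proof.
apply/permP=> e; apply: enum_val_inj; rewrite !permM translE !rhoE translE /=.
by rewrite /wr_act /= addrAC.
Qed.

Lemma translM u w : transl u * transl w = transl (u + w)%R.
Proof.
by apply/permP=> e; apply: enum_val_inj; rewrite permM !translE /= addrA.
Qed.

Lemma transl0 : transl 0%R = 1.
Proof.
apply/permP=> e; apply: enum_val_inj.
by rewrite perm1 translE addr0 -surjective_pairing.
Qed.

Lemma transl_injective : injective transl.
Proof.
move=> u w /permP/(_ base_edge)/(congr1 enum_val).
by rewrite !translE enum_rankK /= !add0r => -[].
Qed.

(* A nonzero element of the kernel of L fixes exactly the edges above 0, so an
   automorphism preserves this fibre, on which it agrees with a translation. *)
Lemma wr_dessin_autE :
  dessin_aut D = [set transl u | u : bool * bool] :> {set _}.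
Proof.
rewrite /= dessin_aut_setE; apply/setP=> a; rewrite /= -rho_im.
apply/centP/imsetP; last first.
  by case=> u _ -> _ /morphimP[g _ _ ->]; apply: commute_transl.
move=> aC; have ca g e : a (rho g e) = rho g (a e).
  have /aC/permP/(_ e) := mem_morphim rho_morphism (in_setT g) (in_setT g).
  by rewrite !permM.
pose e0 := base_edge.
have [k Lk0 Lk] := Lker.
have fixe0 : rho (k, 0%R) e0 = e0.
  by rewrite rho_rank /wr_act /= shift0 Lk0 !addr0.
have ae0 : (enum_val (a e0)).1 = 0%R.
  apply: contraTeq isT => /Lk; have /(congr1 enum_val) := ca (k, 0%R) e0.
  rewrite fixe0 rhoE /wr_act => /(congr1 snd)/= /esym/eqP.
  by rewrite -subr_eq0 addrAC subrr add0r => /eqP.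
exists (enum_val (a e0)).2 => //; apply/permP=> e.
have /orbitP[_ /morphimP[g _ _ ->] <-] :
    e \in orbit 'P (rho @* [set: wreath]) e0.
  by rewrite rho_im (atransP rho_trans) ?inE.
have tc : transl (enum_val (a e0)).2 (rho g e0) =
          rho g (transl (enum_val (a e0)).2 e0).
  by rewrite -!permM commute_transl.
rewrite /= apermE ca tc; congr (rho g _); apply: enum_val_inj.
by rewrite translE enum_rankK /= add0r -ae0 -surjective_pairing.
Qed.

(** This determines the automorphism group up to isomorphism, whatever [L] is. *)
Lemma wr_dessin_aut : 2.-abelem (dessin_aut D) /\ #|dessin_aut D| = 4.
Proof.
split; last first.
  rewrite wr_dessin_autE card_imset ?card_prod ?card_bool //.
  exact: transl_injective.
apply/abelemP=> //; rewrite wr_dessin_autE; split=> [|_ /imsetP[u _ ->]].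
  apply/centsP=> _ /imsetP[u _ ->] _ /imsetP[w _ ->].
  by rewrite /commute !translM addrC.
by rewrite expgS expg1 translM -transl0; congr transl; case: u => -[] [].
Qed.

(* A power h of g fixing an edge has trivial rotation part, so its vector is
   shift-invariant, as h commutes with g, and in the kernel of L. *)
Lemma card_porbit_rho (g : wreath) e : g.2 != 0%R -> #|porbit (rho g) e| = #[g].
Proof.
move=> g0; rewrite porbitE -[RHS](order_injm rho_inj) ?inE //.
rewrite -[RHS](card_orbit_stab 'P <[rho g]> e).
suff -> : 'C_(<[rho g]>)[e | 'P] = 1 by rewrite cards1 muln1.
apply/trivgP/subsetP=> _ /setIP[/cycleP[m ->] /astab1P/=].
rewrite apermE -morphX ?inE // => fixe; suff -> : g ^+ m = 1 by rewrite morph1.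
have := commuteX m (commute_refl g); case: (g ^+ m) fixe => w j fixe.
have {fixe} := congr1 enum_val fixe; rewrite rhoE; case: (enum_val e) => i u.
move=> fixe; have j0 : j = 0%R.
  by apply: (addrI i); rewrite addr0; apply: (congr1 fst fixe).
have {fixe} Lw : L (shift i w) = 0%R.
  by apply: (addrI u); rewrite addr0; apply: (congr1 snd fixe).
rewrite j0 => /(congr1 fst); rewrite !wr_mulE /= shift0 [LHS]addrC.
move/addIr/(shift_fixed g0) => wfix; congr (_, _); apply: Lfaithful => l.
by rewrite wfix -(wfix i).
Qed.

End Action.

(** * Uniform cycle structures, and Z-orientability by edge labellings *)

Lemma cycle_structure_uniform n k (s t : 'S_n) : 0 < k ->
    (forall e, #|porbit s e| = k) -> (forall e, #|porbit t e| = k) ->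
  cycle_structure s = cycle_structure t.
Proof.
move=> k0 sk tk.
(* The cycles partition the points into blocks of size [k], so the unsorted list is already
   constant. *)
have uni (p : 'S_n) : (forall e, #|porbit p e| = k) ->
    [seq #|c| | c : {set 'I_n} in porbits p] = nseq (n %/ k) k.
  move=> pk; have ck c : c \in porbits p -> #|c| = k by case/imsetP=> e _ ->.
  have part : partition (porbits p) [set: 'I_n].
    have -> : porbits p = orbit 'P <[p]> @: [set: 'I_n].
      apply/setP=> c; apply/imsetP/imsetP=> -[e _ ->];
        by exists e; rewrite ?porbitE.
    by apply: orbit_partition; apply/actsP=> a _ e; rewrite !inE.
  have <- : #|porbits p| = n %/ k.
    rewrite -[in RHS](card_ord n) -cardsT.
    by rewrite (card_uniform_partition ck part) mulnK.
  rewrite -(size_image (fun c : {set 'I_n} => #|c|)).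
  by apply/all_pred1P/allP=> _ /imageP[c pc ->] /=; rewrite ck.
by rewrite /cycle_structure !uni.
Qed.

(** Each edge takes the label of its left face. As [sigmaoo] undoes [sigma0 * sigma1], a label kept
    by [sigmaoo] and flipped by [sigma1] is flipped by [sigma0]. In this form a twist only permutes
    the roles of the three permutations. *)
Lemma Z_orientableP n (D : dessin n) :
  reflect (exists l : 'I_n -> bool, forall e,
             [/\ l (sigma0 D e) = ~~ l e, l (sigma1 D e) = ~~ l e
               & l (sigmaoo D e) = l e])
          (Z_orientable D).
Proof.
have invo s e : porbit s (s e : 'I_n) = porbit s e by apply: (porbit_perm s 1).
apply: (iffP existsP) => [[lab /forallP labP]|[l lP]].
  exists (fun e => lab (left_face D e)) => e.
  have loo e' : lab (left_face D (sigmaoo D e')) = lab (left_face D e').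
    by rewrite /left_face invo.
  have l1 e' : lab (left_face D (sigma1 D e')) = ~~ lab (left_face D e').
    have := labP e'; rewrite /right_face -/(left_face D _).
    by do 2!case: (lab _).
  split=> //; apply: (canRL negbK); rewrite -l1 -loo /sigmaoo.
  congr (lab (left_face D _)).
  by rewrite -!permM ?mulgA mulgV perm1.
(* As [l] is constant on each face, this is its common value there. *)
exists [ffun c : {set 'I_n} => [exists e in c, l e]]; apply/forallP=> e.
have labE e' : [exists f in left_face D e', l f] = l e'.
  apply/existsP/idP=> [[f /andP[/porbitP[i ->]]]|le]; last first.
    by exists e'; rewrite porbit_id.
  suff -> : l ((sigmaoo D ^+ i) e') = l e' by [].
  elim: i => [|i IHi]; first by rewrite perm1.
  by rewrite expgSr permM; have [_ _ ->] := lP ((sigmaoo D ^+ i) e').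
rewrite !ffunE /right_face -/(left_face D _) !labE; have [_ -> _] := lP e.
by case: (l e).
Qed.

(** * The two linear maps and their dessins *)

Definition LD (v : V) : bool * bool := (v 0, \sum_k v k)%R.

Lemma LD_additive : nmod_morphism LD.
Proof.
split=> [|v w]; rewrite /LD.
  by rewrite ffunE big1 // => k _; rewrite ffunE.
rewrite ffunE; congr (_, _); rewrite -big_split /=.
by apply: eq_bigr => k _; rewrite ffunE.
Qed.
HB.instance Definition _ :=
  GRing.isNmodMorphism.Build V (bool * bool)%type LD LD_additive.

(** The kernel is spanned by [delta 0], of odd weight, while that of [LD] is spanned by
    [delta 1 + delta (1 + 1)], of even weight, so that parity is well defined on its cosets. *)
Definition LE (v : V) : bool * bool := (v 1, v (1 + 1))%R.

Lemma LE_additive : nmod_morphism LE.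
Proof. by split=> [|v w]; rewrite /LE !ffunE. Qed.
HB.instance Definition _ :=
  GRing.isNmodMorphism.Build V (bool * bool)%type LE LE_additive.

Lemma sum_shift i (v : V) : (\sum_k shift i v k = \sum_k v k)%R.
Proof.
by rewrite [RHS](reindex_inj (addIr i)); apply: eq_bigr => k _; rewrite ffunE.
Qed.

Lemma sum_delta i : (\sum_k delta i k = 1)%R.
Proof.
rewrite (bigD1 i) //= ffunE eqxx big1 ?addr0 // => k /negPf ki.
by rewrite ffunE ki.
Qed.

Lemma LD_surj u : exists v, LD v = u.
Proof.
case: u => a b.
(* [LD] maps [delta 0] to (1, 1) and [delta 1] to (0, 1). *)
exists ((if a then delta 0 else 0) + (if a (+) b then delta 1 else 0))%R.
rewrite raddfD; move: a b => [] [];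
  by rewrite /= ?raddf0 /= /LD ?sum_delta ?ffunE.
Qed.

Lemma LD_faithful v : (forall i, LD (shift i v) = 0%R) -> v = 0%R.
Proof.
move=> v0; apply/ffunP=> i; have /(congr1 fst) := v0 i.
by rewrite /= !ffunE add0r.
Qed.

Lemma LD_ker :
  exists2 k, LD k = 0%R & forall i, i != 0%R -> LD (shift i k) <> 0%R.
Proof.
exists (delta 1 + delta (1 + 1))%R => [|i i0].
  by rewrite raddfD /= /LD !sum_delta !ffunE.
by case: i i0 => [[|[|[]]]] //= ? _ /(congr1 fst); rewrite /= !ffunE.
Qed.

Lemma LE_surj u : exists v, LE v = u.
Proof.
case: u => a b.
exists ((if a then delta 1 else 0) + (if b then delta (1 + 1) else 0))%R.
rewrite raddfD; move: a b => [] [];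
  by rewrite /= ?raddf0 /= /LE ?ffunE.
Qed.

Lemma LE_faithful v : (forall i, LE (shift i v) = 0%R) -> v = 0%R.
Proof.
move=> v0; apply/ffunP=> i; have /(congr1 fst) := v0 (i - 1)%R.
by rewrite /= !ffunE addrC subrK.
Qed.

Lemma LE_ker :
  exists2 k, LE k = 0%R & forall i, i != 0%R -> LE (shift i k) <> 0%R.
Proof.
exists (delta 0%R) => [|i i0]; first by rewrite /LE !ffunE.
by case: i i0 => [[|[|[]]]] //= ? _ [] /=; rewrite !ffunE.
Qed.

Definition dessinD := wr_dessin LD_surj.
Definition dessinE := wr_dessin LE_surj.

Lemma wr_passport : passport dessinD = passport dessinE.
Proof.
have same (g : wreath) : g.2 != 0%R ->
    cycle_structure (rho LD g) = cycle_structure (rho LE g).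
  move=> g0; apply: (@cycle_structure_uniform _ #[g]); first exact: order_gt0.
    by move=> e; apply: card_porbit_rho g0; apply: LD_faithful.
  by move=> e; apply: card_porbit_rho g0; apply: LE_faithful.
by rewrite /passport /dessinD /dessinE !wr_sigmaoo /= !same.
Qed.

(** The last coordinate of an edge is a parity label: a group element changes it by its weight,
    which is odd for [wx] and [wy] and zero for [rot]. *)
Lemma dessinD_orientable : Z_orientable dessinD.
Proof.
apply/Z_orientableP; exists (fun e => (enum_val e).2.2) => e.
have act g : (enum_val (rho LD g e)).2.2 = ((enum_val e).2.2 + \sum_k g.1 k)%R.
  by rewrite rhoE /= sum_shift.
have add1 (b : bool) : (b + 1)%R = ~~ b by case: b.
rewrite /dessinD wr_sigmaoo /= !act; split=> /=.
- by rewrite sum_delta add1.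
- by rewrite !shiftr0 addr0 sum_shift sum_delta add1.
by rewrite big1 ?addr0 // => k _; rewrite ffunE.
Qed.

Lemma tot_dessinE : tot dessinE = 0.
Proof.
have soo : sigmaoo dessinE = rho LE rot by apply: wr_sigmaoo.
have rot3 e : rho LE rot (rho LE rot (rho LE rot e)) = e.
  have rot3 : rot * (rot * rot) = 1.
    by rewrite -[LHS]/(rot ^+ 3) rotX; congr (_, _); apply: val_inj.
  by rewrite -!permM -!rhoM ?inE // -?mulgA rot3 morph1 perm1.
(* The vector [delta 0] of [wx] lies in the kernel of [LE]. Hence no label can be flipped by
   [sigma0] and kept by [sigmaoo] at this edge. *)
have fix0 : rho LE wx base_edge = rho LE rot base_edge.
  rewrite !rho_rank /wr_act /= !shift0 raddf0; congr (enum_rank (_, _)).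
  by rewrite /LE !ffunE.
(* A label cannot alternate around a cycle of odd length; this excludes both twists, where [rot] is
   a vertex permutation. *)
have norot (l : _ -> bool) : ~ forall e, l (rho LE rot e) = ~~ l e.
  move=> lr; have := lr (rho LE rot (rho LE rot base_edge)).
  by rewrite rot3 !lr; case: (l _).
rewrite /tot; case: Z_orientableP => [[l lP]|_].
  have [l0 _ loo] := lP base_edge.
  by move: loo; rewrite soo -fix0 -[rho LE wx]/(sigma0 dessinE) l0; case: (l _).
case: Z_orientableP => [[l lP]|_].
  by case: (norot l) => e; have [_ ] := lP e; rewrite /= soo.
case: Z_orientableP => [[l lP]|_] //.
by case: (norot l) => e; have [] := lP e; rewrite /= sigmaoo_twist soo.
Qed.

Theorem theorem2 :
  exists (n m : nat) (D : dessin n) (E : dessin m),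
    [/\ (monodromy D \isog monodromy E)%g,
        (forall (e : 'I_n) (f : 'I_m), (edge_stab D e \isog edge_stab E f)%g),
        (dessin_aut D \isog dessin_aut E)%g,
        passport D = passport E
      & tot D <> tot E].
Proof.
exists _, _, dessinD, dessinE; split.
- rewrite (isog_trans (isog_symr (wr_monodromy_isog LD_surj LD_faithful))) //.
  exact: wr_monodromy_isog LE_faithful.
- move=> e f; have cD := card_edge_stab LD_surj LD_faithful e.
  have cE := card_edge_stab LE_surj LE_faithful f.
  (* Both stabilisers have prime order 2. *)
  by rewrite isog_cyclic_card ?prime_cyclic ?cD ?cE.
- have [aD cD] := wr_dessin_aut LD_surj LD_ker.
  have [aE cE] := wr_dessin_aut LE_surj LE_ker.
  by rewrite (isog_abelem_card _ aD) aE cD cE.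
- exact: wr_passport.
(* The orientability of [dessinD] itself makes its tot positive. *)
- by rewrite tot_dessinE /tot dessinD_orientable.
Qed.
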